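(* Let $\mathrm{CTL}_\pm$, $\mathrm{PastCTL}_\pm$, $\mathrm{PastCTL}$ and $\mathrm{CTL}$ be the temporal logics defined in the context. Then $\mathrm{CTL}_\pm \subseteq \mathrm{PastCTL}_\pm \subseteq \mathrm{PastCTL}$ (syntactically), and moreover: (1) $\mathrm{CTL}_\pm$ is strictly less expressive than $\mathrm{PastCTL}_\pm$; (2) $\mathrm{PastCTL}_\pm$ and $\mathrm{CTL}$ are incomparable in expressive power; (3) $\mathrm{PastCTL}_\pm$ is strictly less expressive than $\mathrm{PastCTL}$.
   Context: Fix a finite set $AP$ of atomic propositions and $\Sigma=2^{AP}$. A $\Sigma$-tree is a tree that is unranked (each node has finitely many children), unordered and leafless (each node has at least one child), with a labelling $t(v)\in\Sigma$ of each node $v$. A path is a finite or infinite sequence of nodes, each (after the first) a child of the previous one. $\mathrm{PastCTL}^*$: state formulae $\varphi ::= p \mid \neg\varphi \mid \varphi\lor\varphi \mid \mathsf{D}^n\varphi \mid \mathsf{E}\psi$ and path formulae $\psi ::= \varphi \mid \neg\psi \mid \psi\lor\psi \mid \mathsf{X}\psi \mid \mathsf{Y}\psi \mid \psi\,\mathsf{U}\,\psi \mid \psi\,\mathsf{R}\,\psi \mid \psi\,\mathsf{S}\,\psi$ ($p\in AP$, $n\ge 1$). Semantics on a pointed tree $(t,u)$: $p$ holds iff $p\in t(u)$; Booleans as usual; $\mathsf{D}^n\varphi$ holds iff $u$ has at least $n$ distinct children satisfying $\varphi$; $\mathsf{E}\psi$ holds iff there is an infinite path $\pi$ starting at the root of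 $t$ with $\pi(i)=u$ for some $i$ and $(t,\pi,i)\models\psi$. On $(t,\pi,i)$: a state formula holds iff it holds at $(t,\pi(i))$; $\mathsf{X}\psi$ iff $(t,\pi,i+1)\models\psi$; $\mathsf{Y}\psi$ iff $i>0$ and $(t,\pi,i-1)\models\psi$; $\psi_1\mathsf{U}\psi_2$ iff some $j\ge i$ has $\psi_2$ at $j$ and $\psi_1$ at all $k\in[i,j)$; $\psi_1\mathsf{R}\psi_2$ iff $\psi_2$ holds at all $j\ge i$, or some $j\ge i$ has $\psi_1\land\psi_2$ at $j$ and $\psi_2$ at all $k\in[i,j)$; $\psi_1\mathsf{S}\psi_2$ iff some $j\le i$ has $\psi_2$ at $j$ and $\psi_1$ at all $k\in(j,i]$. $\mathrm{PastCTL}$ is the fragment of $\mathrm{PastCTL}^*$ in which every future temporal operator ($\mathsf{X},\mathsf{U},\mathsf{R}$) is immediately preceded by the path quantifier $\mathsf{E}$. $\mathrm{CTL}$ is the fragment of $\mathrm{PastCTL}$ without the past operators $\mathsf{Y},\mathsf{S}$. $\mathrm{PastCTL}_\pm$ is given by the grammar $\varphi ::= p \mid \neg\varphi\mid\varphi\lor\varphi\mid \mathsf{D}^n\varphi\mid \mathsf{E}\mathsf{X}\varphi\mid \mathsf{E}(\varphi\,\mathsf{U}\,\varphi)\mid \mathsf{E}\mathsf{Y}\varphi\mid\mathsf{E}(\varphi\,\mathsf{S}\,\varphi)$ (with the $\mathrm{PastCTL}^*$ semantics), and $\mathrm{CTL}_\pm$ is its fragment without $\mathsf{E}\mathsf{Y}$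 and $\mathsf{E}\mathsf{S}$. A tree $t$ is a model of a state formula $\varphi$ if $\varphi$ holds at the root of $t$; two state formulae are initially equivalent if they have the same models. A logic $L_1$ is strictly less expressive than $L_2$ if every formula of $L_1$ can be effectively translated into an initially equivalent formula of $L_2$ but not vice versa; $L_1$ and $L_2$ are incomparable if some formula of $L_1$ has no initially equivalent formula in $L_2$ and some formula of $L_2$ has no initially equivalent formula in $L_1$. *)

(* Defs.v *)
From mathcomp Require Import all_boot.
Set Implicit Arguments. Unset Strict Implicit. Unset Printing Implicit Defensive.

Section PastCTL.
Variable AP : finType.

(* A Sigma-tree (Sigma = 2^AP), unranked, unordered, leafless.  Nodes are
   addresses [seq nat]: the root is [::], and the children of a node w are
   [rcons w c] for c < arity w.  Every node has arity >= 1 (leafless) and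
   finitely many children.  The order of children is irrelevant for the
   semantics (D^n only counts children), so this represents unordered trees. *)
Record tree := Tree {
  arity : seq nat -> nat;
  lab : seq nat -> {set AP};
  arity_pos : forall w, 0 < arity w }.

Definition root_path (t : tree) (pi : nat -> seq nat) : Prop :=
  pi 0 = [::] /\
  forall i, exists2 c, c < arity t (pi i) & pi i.+1 = rcons (pi i) c.

(* PastCTL* syntax: state formulae and path formulae.
   [SD n f] stands for D^(n+1) f, so that the index is >= 1 as in the paper. *)
Inductive sform : Type :=
  | SAtom of AP
  | SNeg of sform
  | SOr of sform & sform
  | SD of nat & sform
  | SE of pform
with pform : Type :=
  | PState of sform
  | PNeg of pform
  | POr of pform & pform
  | PX of pform
  | PY of pform
  | PU of pform & pform
  | PR of pform & pform
  | PS of pform & pform.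

Fixpoint ssat (t : tree) (u : seq nat) (f : sform) {struct f} : Prop :=
  match f with
  | SAtom p => p \in lab t u
  | SNeg f1 => ~ ssat t u f1
  | SOr f1 f2 => ssat t u f1 \/ ssat t u f2
  | SD n f1 => exists s : seq nat,
      [/\ uniq s, size s = n.+1 &
          forall c, c \in s -> c < arity t u /\ ssat t (rcons u c) f1]
  | SE g => exists pi, root_path t pi /\ exists i, pi i = u /\ psat t pi i g
  end
with psat (t : tree) (pi : nat -> seq nat) (i : nat) (g : pform) {struct g}
  : Prop :=
  match g with
  | PState f => ssat t (pi i) f
  | PNeg g1 => ~ psat t pi i g1
  | POr g1 g2 => psat t pi i g1 \/ psat t pi i g2
  | PX g1 => psat t pi i.+1 g1
  | PY g1 => 0 < i /\ psat t pi i.-1 g1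
  | PU g1 g2 => exists2 j, i <= j &
      psat t pi j g2 /\ forall k, i <= k < j -> psat t pi k g1
  | PR g1 g2 => (forall j, i <= j -> psat t pi j g2) \/
      exists2 j, i <= j &
        [/\ psat t pi j g1, psat t pi j g2 &
            forall k, i <= k < j -> psat t pi k g2]
  | PS g1 g2 => exists2 j, j <= i &
      psat t pi j g2 /\ forall k, j < k <= i -> psat t pi k g1
  end.

Definition init_equiv (f g : sform) : Prop :=
  forall t : tree, ssat t [::] f <-> ssat t [::] g.

Fixpoint is_ctlpm (past : bool) (f : sform) : bool :=
  match f with
  | SAtom _ => true
  | SNeg f1 => is_ctlpm past f1
  | SOr f1 f2 => is_ctlpm past f1 && is_ctlpm past f2
  | SD _ f1 => is_ctlpm past f1
  | SE (PX (PState f1)) => is_ctlpm past f1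
  | SE (PU (PState f1) (PState f2)) => is_ctlpm past f1 && is_ctlpm past f2
  | SE (PY (PState f1)) => past && is_ctlpm past f1
  | SE (PS (PState f1) (PState f2)) =>
      [&& past, is_ctlpm past f1 & is_ctlpm past f2]
  | _ => false
  end.

(* PastCTL (past = true) and CTL (past = false): every future operator
   X, U, R is immediately preceded by E.  [nofut] checks a path formula
   containing no future operator at its top level (only Booleans, and Y, S
   when past = true), whose state subformulae are again in the logic. *)
Fixpoint is_pctl (past : bool) (f : sform) : bool :=
  let fix nofut (g : pform) : bool :=
    match g with
    | PState f1 => is_pctl past f1
    | PNeg g1 => nofut g1
    | POr g1 g2 => nofut g1 && nofut g2
    | PY g1 => past && nofut g1
    | PS g1 g2 => [&& past, nofut g1 & nofut g2]
    | _ => false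
    end in
  match f with
  | SAtom _ => true
  | SNeg f1 => is_pctl past f1
  | SOr f1 f2 => is_pctl past f1 && is_pctl past f2
  | SD _ f1 => is_pctl past f1
  | SE (PX g1) => nofut g1
  | SE (PU g1 g2) => nofut g1 && nofut g2
  | SE (PR g1 g2) => nofut g1 && nofut g2
  | SE g => nofut g
  end.

Definition CTLpm := is_ctlpm false.
Definition PastCTLpm := is_ctlpm true.
Definition PastCTL := is_pctl true.
Definition CTL := is_pctl false.

Definition strictly_less (L1 L2 : sform -> bool) : Prop :=
  (exists tr : sform -> sform,
      forall f, L1 f -> L2 (tr f) /\ init_equiv f (tr f)) /\
  (exists g, L2 g /\ forall f, L1 f -> ~ init_equiv f g).

Definition incomparable (L1 L2 : sform -> bool) : Prop :=
  (exists f, L1 f /\ forall g, L2 g -> ~ init_equiv f g) /\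
  (exists g, L2 g /\ forall f, L1 f -> ~ init_equiv g f).

End PastCTL.

(* Main.v *)
Require Import Defs.
From mathcomp Require Import all_boot.
From mathcomp Require Import zify boolp.
Set Implicit Arguments.
Unset Strict Implicit.
Unset Printing Implicit Defensive.

(**
Formulae are compared on families of trees carrying a decreasing sequence of
relations [R n] between nodes, where [R n.+1]-related nodes have [R n]-related
children.  If the until, release or since operators at hand respect such a
sequence, then by induction every formula is preserved by some [R n], and cannot
express a property that tells apart [R n]-related roots for every [n].

The PastCTL± formula "some node with a single child is reached along a path on
which [p] alternates" is not expressible in CTL.  In the trees used, every move
keeps or flips the colour and uses up fuel; single-child sinks are reachable
either from a good state or after a move that keeps the colour.  With enough
fuel left only the colour matters to CTL, which cannot link the colour of a node
to that of its predecessor: a path to a sink is imitated from a bad state by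
first wasting a move.

The CTL formula EG [p] is not expressible in PastCTL±.  Compare the binary tree
in which [p] holds at depth < M with the one in which it holds at distance < M
from the leftmost branch.  A formula that is small with respect to M sees only
the depth of a node and its distance to the boundary of the region where [p]
holds, both truncated: until and since do not count repetitions, and no finite
part of the infinite branch on which [p] holds is visible.
*)

Scheme sform_pform_ind := Induction for sform Sort Prop
  with pform_sform_ind := Induction for pform Sort Prop.

(** * Nodes and root paths *)

Section RootPaths.
Variables (AP : finType) (t : tree AP).
Implicit Types (u v : seq nat) (next : seq nat -> nat).

Inductive node : seq nat -> Prop :=
  | node_root : node [::]
  | node_child u c : node u -> c < arity t u -> node (rcons u c).

Lemma node_rcons u c : node (rcons u c) <-> node u /\ c < arity t u.
Proof.
split=> [nuc|[nu lc]]; last exact: node_child.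
inversion nuc as [E|v d nv ld E]; first by case: u {nuc} E.
by case/rcons_inj: E => <- <-.
Qed.

Lemma node_nth u i : node u -> i < size u -> nth 0 u i < arity t (take i u).
Proof.
move=> nu; elim: nu => // {}u c _ IH lc; rewrite size_rcons ltnS leq_eqVlt.
case/predU1P => [->|li]; rewrite nth_rcons -cats1.
  by rewrite ltnn eqxx take_size_cat.
by rewrite li takel_cat ?IH // ltnW.
Qed.

Lemma root_path_size pi i : root_path t pi -> size (pi i) = i.
Proof.
case=> p0 pS; elim: i => [|i IH]; first by rewrite p0.
by have [c _ ->] := pS i; rewrite size_rcons IH.
Qed.

Lemma root_path_parent pi i u c :
  root_path t pi -> pi i.+1 = rcons u c -> pi i = u.
Proof. by case=> _ pS; have [d _ ->] := pS i; case/rcons_inj. Qed.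

Definition extension u next (k : nat) : seq nat :=
  iter (k - size u) (fun v => rcons v (next v)) (take k u).

Lemma extension_size u next : extension u next (size u) = u.
Proof. by rewrite /extension subnn take_size. Qed.

Lemma extensionS u next k : size u <= k ->
  let v := extension u next k in extension u next k.+1 = rcons v (next v).
Proof. by move=> lk; rewrite /extension subSn // !take_oversize // ltnW. Qed.

Lemma root_path_extension u next :
  node u -> (forall v, next v < arity t v) -> root_path t (extension u next).
Proof.
move=> nu lnext; split=> [|i]; first by rewrite /extension sub0n take0.
case: (ltnP i (size u)) => [li|lu]; last first.
  by exists (next (extension u next i)); rewrite ?extensionS.
exists (nth 0 u i); rewrite /extension (eqP (ltnW li)) /=.
  exact: node_nth.
by rewrite (eqP li) /= -take_nth.
Qed.

Lemma root_path_exists u :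
  node u -> exists2 pi, root_path t pi & pi (size u) = u.
Proof.
move=> nu; exists (extension u (fun=> 0)); last exact: extension_size.
by apply: root_path_extension => // v; exact: arity_pos.
Qed.

End RootPaths.

(** * Path quantification over node properties *)

Section PathFormulas.
Variables (AP : finType) (t : tree AP).
Implicit Types (u v w : seq nat) (P Q X : seq nat -> Prop) (g : pform AP).

Definition determined g P :=
  forall pi i, root_path t pi -> (psat t pi i g <-> P (pi i)).

Lemma determined_state f : determined (PState f) (fun u => ssat t u f).
Proof. by []. Qed.

Lemma determined_Y g P : determined g P ->
  determined (PY g) (fun u => exists w c, u = rcons w c /\ P w).
Proof.
move=> gP pi i rp; split=> [[]|[w [c [Ei Pw]]]].
  case: i => // i _ /gP - /(_ rp) Pi.
  by have [c _ E] := rp.2 i; exists (pi i), c.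
have Si : i = (size w).+1 by rewrite -(root_path_size i rp) Ei size_rcons.
rewrite {}Si in Ei *; split=> //.
by apply/gP; rewrite ?(root_path_parent rp Ei).
Qed.

Inductive since P Q : seq nat -> Prop :=
  | since_here u : Q u -> since P Q u
  | since_child u c : P (rcons u c) -> since P Q u -> since P Q (rcons u c).

Lemma since_nil P Q : since P Q [::] <-> Q [::].
Proof.
split=> [|Q0]; last exact: since_here.
by move Eu: [::] => u Su; case: Su Eu => // -[].
Qed.

Lemma since_rcons P Q u c :
  since P Q (rcons u c) <-> Q (rcons u c) \/ P (rcons u c) /\ since P Q u.
Proof.
split=> [|[|[]]]; [|exact: since_here | exact: since_child].
move Ew: (rcons u c) => w Sw; case: Sw Ew => [v Qv _|v d Pv Sv]; first by left.
by case/rcons_inj=> -> _; right.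
Qed.

Lemma psat_S0 pi g1 g2 : psat t pi 0 (PS g1 g2) <-> psat t pi 0 g2.
Proof.
split=> [[j]|H]; first by rewrite leqn0 => /eqP -> [].
by exists 0 => //; split=> // k; lia.
Qed.

Lemma psat_SS pi i g1 g2 : psat t pi i.+1 (PS g1 g2) <->
  psat t pi i.+1 g2 \/ psat t pi i.+1 g1 /\ psat t pi i (PS g1 g2).
Proof.
split=> [[j]|[H2|[H1 [j lj [H2 Hk]]]]].
- rewrite leq_eqVlt => /predU1P[-> [H2 _]|lj [H2 Hk]]; first by left.
  right; split; first by apply: Hk; lia.
  by exists j => //; split=> // k lk; apply: Hk; lia.
- by exists i.+1 => //; split=> // k; lia.
exists j; first exact: leqW.
split=> // k /andP[jk]; rewrite leq_eqVlt => /predU1P[-> //|ki].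
by apply: Hk; rewrite jk.
Qed.

Lemma determined_S g1 g2 P Q : determined g1 P -> determined g2 Q ->
  determined (PS g1 g2) (since P Q).
Proof.
move=> gP gQ pi i rp; elim: i => [|i IH].
  by rewrite psat_S0 (gQ _ _ rp) rp.1 since_nil.
rewrite psat_SS IH (gP _ _ rp) (gQ _ _ rp).
by have [c _ ->] := rp.2 i; rewrite since_rcons.
Qed.

Lemma ssat_E g P u : determined g P -> node t u -> ssat t u (SE g) <-> P u.
Proof.
move=> gP nu; split=> [[pi [rp [i [<- /gP]]]]|Pu]; first exact.
have [pi rp E] := root_path_exists nu.
by exists pi; split=> //; exists (size u); split=> //; apply/gP; rewrite ?E.
Qed.

Lemma ssat_EX g P u : determined g P -> node t u ->
  ssat t u (SE (PX g)) <-> exists2 c, c < arity t u & P (rcons u c).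
Proof.
move=> gP nu; split=> [[pi [rp [i [<- /gP - /(_ rp) Pi]]]]|[c lc Pu]].
  by have [c lc E] := rp.2 i; exists c => //; rewrite -E.
have [pi rp E] := root_path_exists (node_child nu lc).
rewrite size_rcons in E.
exists pi; split=> //; exists (size u); split.
  exact: root_path_parent rp E.
by apply/gP => //; rewrite E.
Qed.

Inductive reach P Q : seq nat -> Prop :=
  | reach_here u : Q u -> reach P Q u
  | reach_child u c :
      P u -> c < arity t u -> reach P Q (rcons u c) -> reach P Q u.

Lemma reachP P Q u : reach P Q u <->
  Q u \/ P u /\ exists2 c, c < arity t u & reach P Q (rcons u c).
Proof.
split=> [[{}u|{}u c]|[|[Pu [c]]]].
- by left.
- by right; split=> //; exists c.
- exact: reach_here.
- exact: reach_child.
Qed.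

Lemma reach_root P Q : (forall u, P u) ->
  reach P Q [::] <-> exists2 u, node t u & Q u.
Proof.
move=> allP; split=> [|[u nu /(@reach_here P)]].
  move: [::] (node_root t) => u nu ru; elim: ru nu => {u} [u|u c _ lc _ IH nu].
    by exists u.
  exact/IH/node_child.
by elim: nu => // {}u c _ IH lc ruc; apply/IH/(reach_child (allP u) lc).
Qed.

Lemma reach_path P Q u : reach P Q u -> node t u ->
  exists2 pi, root_path t pi & pi (size u) = u /\
    exists2 j, size u <= j & Q (pi j) /\ forall k, size u <= k < j -> P (pi k).
Proof.
elim=> [{}u Qu nu|{}u c Pu lc _ IH nu].
  have [pi rp E] := root_path_exists nu.
  exists pi => //; split=> //; exists (size u); rewrite ?E //.
  by split=> // k; rewrite ltnNge andbN.
have [pi rp] := IH (node_child nu lc); rewrite size_rcons.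
move=> [E [j lj [Qj Pk]]]; have Eu := root_path_parent rp E.
exists pi => //; split=> //; exists j; first exact: ltnW.
split=> // k /andP[]; rewrite leq_eqVlt => /predU1P[<- _|lk kj].
  by rewrite Eu.
by apply: Pk; rewrite lk.
Qed.

Lemma path_reach P Q pi i j : root_path t pi -> i <= j -> Q (pi j) ->
  (forall k, i <= k < j -> P (pi k)) -> reach P Q (pi i).
Proof.
move=> rp /subnK; move: (j - i) => n <-; elim: n i => [|n IH] i Qj Pk.
  exact: reach_here.
have [c lc E] := rp.2 i; apply: (reach_child (c := c)) => //.
  by apply: Pk; lia.
rewrite -E; apply: IH => [|k lk]; first by rewrite addnS -addSn.
by apply: Pk; lia.
Qed.

Lemma ssat_EU g1 g2 P Q u : determined g1 P -> determined g2 Q -> node t u ->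
  ssat t u (SE (PU g1 g2)) <-> reach P Q u.
Proof.
move=> gP gQ nu; split=> [[pi [rp [i [<- [j lij [H2 H1]]]]]]|ru].
  apply: (path_reach rp lij) => [|k lk]; first exact/gQ.
  by apply/gP => //; apply: H1.
have [pi rp [E [j lj [Qj Pk]]]] := reach_path ru nu.
exists pi; split=> //; exists (size u); split=> //; exists j => //.
by split=> [|k lk]; [apply/gQ | apply/gP => //; apply: Pk].
Qed.

(* The greatest fixpoint of [X |-> Q /\ (P \/ EX X)], as the union of its
   post-fixpoints. *)
Inductive release P Q u : Prop :=
  Release X of X u & (forall v, X v ->
    Q v /\ (P v \/ exists2 c, c < arity t v & X (rcons v c))).

Lemma releaseP P Q u : release P Q u <->
  P u /\ Q u \/ Q u /\ exists2 c, c < arity t u & release P Q (rcons u c).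
Proof.
split=> [[X Xu postX]|[[Pu Qu]|[Qu [c lc [X Xc postX]]]]].
- have [Qu [Pu|[c lc Xc]]] := postX _ Xu; [by left | right].
  by split=> //; exists c => //; exists X.
- by exists (eq u) => // v <-; split=> //; left.
exists (fun v => v = u \/ X v) => [|v [->|/postX [Qv H]]]; first by left.
  by split=> //; right; exists c => //; right.
split=> //; case: H => [Pv|[d ld Xd]]; first by left.
by right; exists d => //; right.
Qed.

Lemma release_path P Q u : release P Q u -> node t u ->
  exists2 pi, root_path t pi & pi (size u) = u /\
    ((forall j, size u <= j -> Q (pi j)) \/
     exists2 j, size u <= j &
       [/\ P (pi j), Q (pi j) & forall k, size u <= k < j -> Q (pi k)]).
Proof.
case=> X Xu postX nu.
have [|next nextP] :=
    @choice _ _ (fun v c => c < arity t v /\ (X v -> ~ P v -> X (rcons v c))).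
  move=> v; have [[Xv nPv]|nH] := EM (X v /\ ~ P v).
    by have [_ [//|[c lc Xc]]] := postX _ Xv; exists c.
  by exists 0; split=> [|Xv nPv]; [exact: arity_pos | case: nH].
pose pi := extension u next.
have piE : pi (size u) = u := extension_size u next.
exists pi; first by apply: root_path_extension => // v; exact: (nextP v).1.
split=> //.
have [|noP] := EM (exists2 j, size u <= j &
  [/\ P (pi j), Q (pi j) & forall k, size u <= k < j -> Q (pi k)]).
  by right.
have XQ n : X (pi (size u + n)) /\
    forall k, size u <= k < size u + n -> Q (pi k).
  elim: n => [|n [Xn Qn]]; first by rewrite addn0 piE; split=> // k; lia.
  have [Qv _] := postX _ Xn; rewrite addnS; split.
    rewrite /pi extensionS ?leq_addr //; apply: (nextP _).2 => // Pv.
    by apply: noP; exists (size u + n) => //; exact: leq_addr.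
  move=> k; rewrite ltnS => /andP[lk]; rewrite leq_eqVlt => /predU1P[-> //|kn].
  by apply: Qn; rewrite lk.
by left=> j /subnKC <-; case: (postX _ (XQ (j - size u)).1).
Qed.

Lemma psat_R_inv pi i g1 g2 : psat t pi i (PR g1 g2) ->
  psat t pi i g2 /\ (psat t pi i g1 \/ psat t pi i.+1 (PR g1 g2)).
Proof.
case=> [H2|[j]]; last rewrite leq_eqVlt => /predU1P[-> [H1 H2 _]|lj [H1 Hj H2]].
- split; first exact: H2.
  by right; left=> j lj; apply: H2; exact: ltnW.
- by split=> //; left.
- split; first by apply: H2; rewrite leqnn.
  by right; right; exists j => //; split=> // k lk; apply: H2; lia.
Qed.

Lemma ssat_ER g1 g2 P Q u : determined g1 P -> determined g2 Q -> node t u ->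
  ssat t u (SE (PR g1 g2)) <-> release P Q u.
Proof.
move=> gP gQ nu; split=> [[pi [rp [i [<- Hi]]]]|ru].
  exists (fun v => exists2 k, pi k = v & psat t pi k (PR g1 g2)).
    by exists i.
  move=> _ [k <- /psat_R_inv[/gQ - /(_ rp) Qk H]]; split=> //.
  case: H => [/gP|Hk]; first by left; auto.
  by have [c lc E] := rp.2 k; right; exists c => //; exists k.+1.
have [pi rp [E H]] := release_path ru nu.
exists pi; split=> //; exists (size u); split=> //.
case: H => [H|[j lj [Pj Qj Hk]]]; [left=> j lj | right; exists j => //].
  by apply/gQ => //; apply: H.
by split; [apply/gP | apply/gQ | move=> k lk; apply/gQ => //; apply: Hk].
Qed.

End PathFormulas.

(** * State formulae and induction on CTL± and CTL *)

Section StateFormulas.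
Variable AP : finType.
Implicit Types (t : tree AP) (f : sform AP) (g : pform AP).

Definition STrue (p : AP) : sform AP := SOr (SAtom p) (SNeg (SAtom p)).
Definition SAnd f1 f2 : sform AP := SNeg (SOr (SNeg f1) (SNeg f2)).

Lemma ssat_True t u p : ssat t u (STrue p).
Proof. exact: EM. Qed.

Lemma ssat_Or t u f1 f2 : ssat t u (SOr f1 f2) <-> ssat t u f1 \/ ssat t u f2.
Proof. by []. Qed.

Lemma ssat_And t u f1 f2 : ssat t u (SAnd f1 f2) <-> ssat t u f1 /\ ssat t u f2.
Proof.
split=> [H|[H1 H2] []//].
by split; apply: contrapT => nf; apply: H; [left | right].
Qed.

Lemma init_equiv_sym f1 f2 : init_equiv f1 f2 -> init_equiv f2 f1.
Proof. by move=> E t; split=> /E. Qed.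

Lemma ctlpm_ind (past : bool) (P : sform AP -> Prop) :
    (forall p, P (SAtom p)) ->
    (forall f, P f -> P (SNeg f)) ->
    (forall f1 f2, P f1 -> P f2 -> P (SOr f1 f2)) ->
    (forall n f, P f -> P (SD n f)) ->
    (forall f, P f -> P (SE (PX (PState f)))) ->
    (forall f1 f2, P f1 -> P f2 -> P (SE (PU (PState f1) (PState f2)))) ->
    (forall f, past -> P f -> P (SE (PY (PState f)))) ->
    (forall f1 f2, past -> P f1 -> P f2 ->
       P (SE (PS (PState f1) (PState f2)))) ->
  forall f, is_ctlpm past f -> P f.
Proof.
move=> Patom Pneg Por PD PX PU PY PS.
pose Ps f := is_ctlpm past f -> P f.
pose Pp g := (if g is PState f then Ps f else True) /\ Ps (SE g).
apply: (@sform_pform_ind AP Ps Pp); rewrite /Pp /Ps //=.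
- by move=> f IH /IH; apply: Pneg.
- by move=> f1 IH1 f2 IH2 /andP[/IH1 ? /IH2]; apply: Por.
- by move=> n f IH /IH; apply: PD.
- by move=> g [].
- by move=> [] //= f [IH _]; split=> // /IH; apply: PX.
- by move=> [] //= f [IH _]; split=> // /andP[? /IH]; apply: PY.
- move=> [] //= f1 [IH1 _] [] //= f2 [IH2 _]; split=> // /andP[/IH1 ? /IH2].
  exact: PU.
- move=> [] //= f1 [IH1 _] [] //= f2 [IH2 _]; split=> // /and3P[? /IH1 ? /IH2].
  exact: PS.
Qed.

Lemma is_ctlpm_past f : is_ctlpm false f -> is_ctlpm true f.
Proof. by elim/ctlpm_ind: f / => //= f1 f2 -> ->. Qed.

Lemma is_ctlpm_pctl past f : is_ctlpm past f -> is_pctl past f.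
Proof.
elim/ctlpm_ind: f / => //= [f1 f2 -> -> //|f1 f2 -> -> //|f -> ->//|].
by move=> f1 f2 -> -> ->.
Qed.

(* In CTL a path formula without a leading future operator has no temporal
   operator at all.  The local fixpoint of [is_pctl] that recognizes such
   formulae is reached through [EX]. *)
Definition atemporal g : bool := is_pctl false (SE (PX g)).

(* Junk on formulae that are not [atemporal]. *)
Fixpoint state_form g : sform AP :=
  match g with
  | PState f => f
  | PNeg g1 => SNeg (state_form g1)
  | POr g1 g2 => SOr (state_form g1) (state_form g2)
  | _ => SE g
  end.

Lemma determined_atemporal t g :
  atemporal g -> determined t g (fun u => ssat t u (state_form g)).
Proof.
elim: g => //= [g1 IH /IH H|g1 IH1 g2 IH2 /andP[/IH1 H1 /IH2 H2]] pi i rp.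
  by rewrite /= (H _ _ rp).
by rewrite /= (H1 _ _ rp) (H2 _ _ rp).
Qed.

Lemma ctl_ind (P : sform AP -> Prop) :
    (forall p, P (SAtom p)) ->
    (forall f, P f -> P (SNeg f)) ->
    (forall f1 f2, P f1 -> P f2 -> P (SOr f1 f2)) ->
    (forall n f, P f -> P (SD n f)) ->
    (forall g, atemporal g -> P (state_form g) -> P (SE g)) ->
    (forall g, atemporal g -> P (state_form g) -> P (SE (PX g))) ->
    (forall g1 g2, atemporal g1 -> P (state_form g1) ->
       atemporal g2 -> P (state_form g2) -> P (SE (PU g1 g2))) ->
    (forall g1 g2, atemporal g1 -> P (state_form g1) ->
       atemporal g2 -> P (state_form g2) -> P (SE (PR g1 g2))) ->
  forall f, CTL f -> P f.
Proof.
move=> Patom Pneg Por PD PE PX PU PR.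
pose Ps f := CTL f -> P f.
pose Pp g := (atemporal g -> P (state_form g)) /\ Ps (SE g).
apply: (@sform_pform_ind AP Ps Pp); rewrite /Pp /Ps //=.
- by move=> f IH /IH; apply: Pneg.
- by move=> f1 IH1 f2 IH2 /andP[/IH1 ? /IH2]; apply: Por.
- by move=> n f IH /IH; apply: PD.
- by move=> g [].
- by move=> f IH; split=> // Cf; apply: PE => //; exact: IH.
- move=> g [IH _]; have Pg : atemporal (PNeg g) -> P (state_form (PNeg g)).
    by move=> /IH; apply: Pneg.
  by split=> // ag; apply: PE => //; exact: Pg.
- move=> g1 [IH1 _] g2 [IH2 _].
  have Pg : atemporal (POr g1 g2) -> P (state_form (POr g1 g2)).
    by move=> /andP[/IH1 ? /IH2]; apply: Por.
  by split=> // ag; apply: PE => //; exact: Pg.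
- by move=> g [IH _]; split=> // ag; apply: PX => //; exact: IH.
- move=> g1 [IH1 _] g2 [IH2 _]; split=> // /andP[a1 a2].
  by apply: PU => //; [exact: IH1 | exact: IH2].
- move=> g1 [IH1 _] g2 [IH2 _]; split=> // /andP[a1 a2].
  by apply: PR => //; [exact: IH1 | exact: IH2].
Qed.

End StateFormulas.

(** * Graded simulations *)

Section Preservation.
Variables (AP : finType) (I : Type) (T : I -> tree AP).

Definition node_pred := I -> seq nat -> Prop.
Definition node_rel := I -> seq nat -> I -> seq nat -> Prop.
Implicit Types (P Q : node_pred) (R : node_rel) (f : sform AP).

Definition preserves R P := forall i u j v,
  node (T i) u -> node (T j) v -> R i u j v -> P i u -> P j v.

Definition matches_children R R' := forall i u j v c, R i u j v ->
  c < arity (T i) u -> c < arity (T j) v /\ R' i (rcons u c) j (rcons v c).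

Definition matches_parents R R' := forall i u c j v, R i (rcons u c) j v ->
  exists w d, v = rcons w d /\ R' i u j w.

Lemma preserves_and R P Q :
  preserves R P -> preserves R Q -> preserves R (fun i u => P i u /\ Q i u).
Proof.
move=> pP pQ i u j v nu nv Ruv [Pu Qu].
by split; [exact: pP Pu | exact: pQ Qu].
Qed.

Lemma preserves_reach R P Q :
    matches_children R R -> preserves R P -> preserves R Q ->
  preserves R (fun i => reach (T i) (P i) (Q i)).
Proof.
move=> matchR pP pQ i u j v nu nv Ruv ru.
elim: ru v nu nv Ruv => {u} [u Qu|u c Pu lc _ IH] v nu nv Ruv.
  by apply: reach_here; exact: pQ Qu.
have [ld Rc] := matchR _ _ _ _ _ Ruv lc.
apply: (reach_child (c := c)) => //; first exact: pP Pu.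
by apply: IH => //; exact: node_child.
Qed.

Lemma preserves_release R P Q :
    matches_children R R -> preserves R P -> preserves R Q ->
  preserves R (fun i => release (T i) (P i) (Q i)).
Proof.
move=> matchR pP pQ i u j v nu nv Ruv [X Xu postX].
exists (fun v' => exists2 u', X u' &
  [/\ node (T i) u', node (T j) v' & R i u' j v']).
  by exists u.
move=> v' [u' Xu' [nu' nv' Ruv']]; have [Qu H] := postX _ Xu'.
split; first exact: pQ Qu.
case: H => [Pu|[c lc Xc]]; first by left; exact: pP Pu.
have [ld Rc] := matchR _ _ _ _ _ Ruv' lc.
right; exists c => //; exists (rcons u' c) => //.
by split=> //; exact: node_child.
Qed.

Record graded_simulation (R : nat -> node_rel) : Prop := GradedSimulation {
  graded_sym n i u j v : R n i u j v -> R n j v i u;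
  graded_le m n i u j v : m <= n -> R n i u j v -> R m i u j v;
  graded_lab i u j v : R 0 i u j v -> lab (T i) u = lab (T j) v;
  graded_children n : matches_children (R n.+1) (R n) }.

Variable R : nat -> node_rel.
Hypothesis simR : graded_simulation R.

Definition finite_rank P := exists n, preserves (R n) P.

Definition sat f : node_pred := fun i u => ssat (T i) u f.

Lemma finite_rank_ext P Q : (forall i u, node (T i) u -> P i u <-> Q i u) ->
  finite_rank Q -> finite_rank P.
Proof.
move=> PQ [n pQ]; exists n => i u j v nu nv Ruv /(PQ _ _ nu) Qu.
exact/(PQ _ _ nv)/(pQ _ _ _ _ nu nv Ruv).
Qed.

Lemma finite_rank_common P Q : finite_rank P -> finite_rank Q ->
  exists n, preserves (R n) P /\ preserves (R n) Q.
Proof.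
move=> [m pP] [n pQ]; exists (maxn m n); split=> i u j v nu nv Ruv.
  by apply: pP => //; apply: graded_le Ruv => //; exact: leq_maxl.
by apply: pQ => //; apply: graded_le Ruv => //; exact: leq_maxr.
Qed.

Lemma finite_rank_atom p : finite_rank (sat (SAtom p)).
Proof.
by exists 0 => i u j v _ _ /(graded_lab simR) E; rewrite /sat /= E.
Qed.

Lemma finite_rank_neg f : finite_rank (sat f) -> finite_rank (sat (SNeg f)).
Proof.
move=> [n pf]; exists n => i u j v nu nv Ruv nfu fv.
by apply: nfu; apply: pf fv => //; exact: graded_sym Ruv.
Qed.

Lemma finite_rank_or f1 f2 :
  finite_rank (sat f1) -> finite_rank (sat f2) -> finite_rank (sat (SOr f1 f2)).
Proof.
move=> fr1 fr2; have [n [p1 p2]] := finite_rank_common fr1 fr2.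
exists n => i u j v nu nv Ruv [fu|fu]; first by left; exact: p1 fu.
by right; exact: p2 fu.
Qed.

Lemma finite_rank_transfer_child P : finite_rank P ->
  exists n, forall i u j v c,
    node (T i) u -> node (T j) v -> R n i u j v ->
    c < arity (T i) u -> P i (rcons u c) ->
  c < arity (T j) v /\ P j (rcons v c).
Proof.
move=> [n pP]; exists n.+1 => i u j v c nu nv Ruv lc Pc.
have [ld Rc] := graded_children simR Ruv lc.
by split=> //; apply: pP Pc => //; exact: node_child.
Qed.

Lemma finite_rank_D k f : finite_rank (sat f) -> finite_rank (sat (SD k f)).
Proof.
move=> /finite_rank_transfer_child[n cf].
exists n => i u j v nu nv Ruv [s [us ss Hs]].
by exists s; split=> // c /Hs[lc]; exact: cf Ruv lc.
Qed.

Lemma finite_rank_EX P : finite_rank P ->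
  finite_rank (fun i u => exists2 c, c < arity (T i) u & P i (rcons u c)).
Proof.
move=> /finite_rank_transfer_child[n cP].
exists n => i u j v nu nv Ruv [c lc Pc].
by have [ld Pd] := cP _ _ _ _ _ nu nv Ruv lc Pc; exists c.
Qed.

Lemma finite_rank_EY P : (forall n, matches_parents (R n.+1) (R n)) ->
    finite_rank P ->
  finite_rank (fun i u => exists w c, u = rcons w c /\ P i w).
Proof.
move=> parR [n pP]; exists n.+1 => i u j v nu nv Ruv [w [c [Eu Pw]]].
rewrite {u}Eu in nu Ruv; have [w' [d [Ev Rw]]] := parR _ _ _ _ _ _ Ruv.
rewrite {v Ruv}Ev in nv *; exists w', d; split=> //; apply: pP Rw Pw.
  by have /node_rcons[] := nu.
by have /node_rcons[] := nv.
Qed.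

Definition finite_rank_closed
    (op : tree AP ->
          (seq nat -> Prop) -> (seq nat -> Prop) -> seq nat -> Prop) : Prop :=
  forall n P Q, preserves (R n) P -> preserves (R n) Q ->
  finite_rank (fun i => op (T i) (P i) (Q i)).

Lemma ctl_finite_rank f :
    finite_rank_closed (@reach AP) -> finite_rank_closed (@release AP) ->
  CTL f -> finite_rank (sat f).
Proof.
move=> closedU closedR; elim/ctl_ind: f / => [p|f|f1 f2|k f|g ag|g ag
  |g1 g2 a1 fr1 a2 fr2|g1 g2 a1 fr1 a2 fr2].
- exact: finite_rank_atom.
- exact: finite_rank_neg.
- exact: finite_rank_or.
- exact: finite_rank_D.
- move=> fr; apply: finite_rank_ext fr => i u nu.
  exact: (ssat_E (determined_atemporal ag) nu).
- move=> fr; apply: finite_rank_ext (finite_rank_EX fr) => i u nu.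
  exact: (ssat_EX (determined_atemporal ag) nu).
- have [n [p1 p2]] := finite_rank_common fr1 fr2.
  apply: finite_rank_ext (closedU _ _ _ p1 p2) => i u nu.
  exact: (ssat_EU (determined_atemporal a1) (determined_atemporal a2) nu).
- have [n [p1 p2]] := finite_rank_common fr1 fr2.
  apply: finite_rank_ext (closedR _ _ _ p1 p2) => i u nu.
  exact: (ssat_ER (determined_atemporal a1) (determined_atemporal a2) nu).
Qed.

Lemma pastctlpm_finite_rank f : (forall n, matches_parents (R n.+1) (R n)) ->
    finite_rank_closed (@reach AP) -> finite_rank_closed (fun=> since) ->
  PastCTLpm f -> finite_rank (sat f).
Proof.
move=> parR closedU closedS; elim/ctlpm_ind: f / => [p|f|f1 f2|k f|f fr
  |f1 f2 fr1 fr2|f _ fr|f1 f2 _ fr1 fr2].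
- exact: finite_rank_atom.
- exact: finite_rank_neg.
- exact: finite_rank_or.
- exact: finite_rank_D.
- apply: finite_rank_ext (finite_rank_EX fr) => i u nu.
  exact: (ssat_EX (@determined_state _ _ f) nu).
- have [n [p1 p2]] := finite_rank_common fr1 fr2.
  apply: finite_rank_ext (closedU _ _ _ p1 p2) => i u nu.
  exact: (ssat_EU (@determined_state _ _ f1) (@determined_state _ _ f2) nu).
- apply: finite_rank_ext (finite_rank_EY parR fr) => i u nu.
  exact: (ssat_E (determined_Y (@determined_state _ _ f)) nu).
- have [n [p1 p2]] := finite_rank_common fr1 fr2.
  apply: finite_rank_ext (closedS _ _ _ p1 p2) => i u nu.
  exact: (ssat_E (determined_S (@determined_state _ _ f1)
                               (@determined_state _ _ f2)) nu).
Qed.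

Lemma finite_rank_not_equiv f g : finite_rank (sat f) ->
    (forall n, exists i j, [/\ R n i [::] j [::],
       ssat (T i) [::] g & ~ ssat (T j) [::] g]) ->
  ~ init_equiv f g.
Proof.
move=> [n pf] /(_ n)[i [j [Rij gi ngj]]] fg; apply/ngj/fg.
by apply: (pf i [::]) => //; [exact: node_root | exact: node_root | exact/fg].
Qed.

End Preservation.

(** * A PastCTL± formula that is not expressible in CTL *)

Section AlternatingSink.
Variables (AP : finType) (p : AP).
Implicit Types (t : tree AP) (f : sform AP).

Lemma not_ssat_EY_nil t g : ~ ssat t [::] (SE (PY g)).
Proof.
by case=> pi [rp [i [Ei []]]]; have := root_path_size i rp; rewrite Ei => <-.
Qed.

Lemma ssat_EY_rcons t u c f : node t (rcons u c) ->
  ssat t (rcons u c) (SE (PY (PState f))) <-> ssat t u f.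
Proof.
move=> nuc; rewrite (ssat_E (determined_Y (@determined_state _ _ f)) nuc).
by split=> [[w [d [/rcons_inj[-> _]]]]|fu] //; exists u, c.
Qed.

Lemma ssat_D_True t u n : ssat t u (SD n (STrue p)) <-> n < arity t u.
Proof.
split=> [[s [us ss Hs]]|ln].
  rewrite -ss -(size_iota 0 (arity t u)).
  apply: uniq_leq_size => // c /Hs[lc _].
  by rewrite mem_iota.
exists (iota 0 n.+1); split; rewrite ?iota_uniq ?size_iota // => c.
rewrite mem_iota => lc; split; last exact: ssat_True.
exact: leq_trans lc ln.
Qed.

Definition repeating : sform AP :=
  SOr (SAnd (SAtom p) (SE (PY (PState (SAtom p)))))
      (SAnd (SNeg (SAtom p)) (SE (PY (PState (SNeg (SAtom p)))))).

Lemma not_ssat_repeating_nil t : ~ ssat t [::] repeating.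
Proof. by move=> /ssat_Or[]/ssat_And[_ /not_ssat_EY_nil]. Qed.

Lemma ssat_repeating_rcons t u c : node t (rcons u c) ->
  ssat t (rcons u c) repeating <-> (p \in lab t (rcons u c)) = (p \in lab t u).
Proof.
move=> nuc; rewrite /repeating ssat_Or !ssat_And !ssat_EY_rcons //=.
split=> [[[H H']|[H H']]|->].
- by rewrite H H'.
- by move/negP/negbTE: H => ->; move/negP/negbTE: H' => ->.
- by case: (p \in lab t u); [left | right].
Qed.

Definition alternating : sform AP :=
  SNeg (SE (PS (PState (STrue p)) (PState repeating))).

Lemma ssat_alternating_since t u : node t u -> ssat t u alternating <->
  ~ since (fun v => ssat t v (STrue p)) (fun v => ssat t v repeating) u.
Proof.
move=> nu; have := ssat_E (determined_S (@determined_state _ t (STrue p))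
  (@determined_state _ t repeating)) nu.
by rewrite /alternating /=; tauto.
Qed.

Lemma ssat_alternating_nil t : ssat t [::] alternating.
Proof.
apply/ssat_alternating_since; first exact: node_root.
by move/since_nil; exact: not_ssat_repeating_nil.
Qed.

Lemma ssat_alternating_rcons t u c : node t (rcons u c) ->
  ssat t (rcons u c) alternating <->
  ssat t u alternating /\ (p \in lab t (rcons u c)) = (p \notin lab t u).
Proof.
move=> nuc; have /node_rcons[nu _] := nuc.
have flip : (p \in lab t (rcons u c)) = (p \notin lab t u) <->
    ~ ssat t (rcons u c) repeating.
  rewrite ssat_repeating_rcons //.
  by case: (p \in lab t u); case: (p \in lab t (rcons u c)).
rewrite flip !ssat_alternating_since // since_rcons.
have := ssat_True t (rcons u c) p; tauto.
Qed.

Definition alternating_sink : sform AP :=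
  SE (PU (PState (STrue p))
         (PState (SAnd (SNeg (SD 1 (STrue p))) alternating))).

Lemma ssat_alternating_sink t : ssat t [::] alternating_sink <->
  exists u, [/\ node t u, arity t u = 1 & ssat t u alternating].
Proof.
have sinkE u : ssat t u (SAnd (SNeg (SD 1 (STrue p))) alternating) <->
    arity t u = 1 /\ ssat t u alternating.
  have sink : ~ ssat t u (SD 1 (STrue p)) <-> arity t u = 1.
    by rewrite ssat_D_True; have := arity_pos t u; lia.
  by rewrite ssat_And -sink.
rewrite (ssat_EU (@determined_state _ t _) (@determined_state _ t _)
  (node_root t)) reach_root => [|u]; last exact: ssat_True.
by split=> [[u nu /sinkE[]]|[u [nu au alt]]]; exists u => //; exact/sinkE.
Qed.

End AlternatingSink.

Section ColourTrees.
Variables (AP : finType) (p : AP).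

Record colour_state := ColourState { good : bool; colour : bool; fuel : nat }.
Implicit Types (s : colour_state) (u w : seq nat).

(* Moves 0 and 1 keep the colour and choose [good] freely; moves 2 and 3 flip
   the colour and cannot make a bad state good.  [good] is visible only when no
   fuel is left, through the number of children. *)
Definition colour_step s (c : nat) : colour_state :=
  if fuel s is d.+1
  then ColourState (odd c && (good s || (c < 2))) (colour s (+) (2 <= c)) d
  else s.

Definition colour_arity s : nat :=
  if fuel s is _.+1 then 4 else if good s then 1 else 2.

Lemma colour_arity_gt0 s : 0 < colour_arity s.
Proof. by rewrite /colour_arity; case: fuel => //; case: good. Qed.

Lemma colour_arity_fuel s : 0 < fuel s -> colour_arity s = 4.
Proof. by rewrite /colour_arity; case: fuel. Qed.

Definition run s w : colour_state := foldl colour_step s w.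

Lemma run_rcons s w c : run s (rcons w c) = colour_step (run s w) c.
Proof. exact: foldl_rcons. Qed.

Definition colour_tree s : tree AP :=
  Tree (fun w => if colour (run s w) then [set p] else set0)
       (fun w => colour_arity_gt0 (run s w)).

Lemma lab_colour_tree s w : (p \in lab (colour_tree s) w) = colour (run s w).
Proof. by rewrite /=; case: colour; rewrite inE ?eqxx. Qed.

Definition same_run s w s' w' : Prop := run s w = run s' w'.

Lemma same_run_children : matches_children colour_tree same_run same_run.
Proof. by move=> s w s' w' c E /=; rewrite /same_run !run_rcons E. Qed.

Definition colour_sim n s w s' w' : Prop :=
  colour (run s w) = colour (run s' w') /\
  (n < fuel (run s w) /\ n < fuel (run s' w') \/ run s w = run s' w').

Lemma same_run_colour_sim n s w s' w' :
  same_run s w s' w' -> colour_sim n s w s' w'.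
Proof. by move=> E; split; [rewrite E | right]. Qed.

Lemma graded_colour_sim : graded_simulation colour_tree colour_sim.
Proof.
split=> [n s w s' w' [E H]|m n s w s' w' lmn [E H]|s w s' w' [E _]
  |n s w s' w' c [E H]].
- by split=> //; case: H => [[]|]; [left | right].
- split=> //; case: H => [[l l']|]; [left | by right].
  by split; exact: leq_ltn_trans lmn _.
- by rewrite /= E.
case: H => [[l l']|Er] lc; last first.
  have [lc' Ec] := same_run_children Er lc.
  by split=> //; exact: same_run_colour_sim.
split; first by move: lc; rewrite /= !colour_arity_fuel //; lia.
rewrite /colour_sim !run_rcons /colour_step.
case: (fuel (run s w)) l => // d l; case: (fuel (run s' w')) l' => // d' l'.
by split; [rewrite /= E | left].
Qed.

Section ColourFixpoint.
Variables (n : nat) (A B F : node_pred colour_state).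
Hypothesis A_inv : preserves colour_tree (colour_sim n) A.
Hypothesis B_inv : preserves colour_tree (colour_sim n) B.
Hypothesis F_run : preserves colour_tree same_run F.
Hypothesis F_fix : forall s w, F s w <-> B s w \/ A s w /\
  exists2 c, c < arity (colour_tree s) w & F s (rcons w c).

Lemma preserves_high_fuel P s w s' w' :
    preserves colour_tree (colour_sim n) P ->
    node (colour_tree s) w -> node (colour_tree s') w' ->
    n < fuel (run s w) -> n < fuel (run s' w') ->
    colour (run s w) = colour (run s' w') ->
  P s w -> P s' w'.
Proof. by move=> pP nw nw' l l' E; apply: pP => //; split=> //; left. Qed.

Lemma fixpoint_descend s w :
    (forall v, node (colour_tree s) v -> n < fuel (run s v) -> ~ B s v) ->
    node (colour_tree s) w -> n < fuel (run s w) -> F s w ->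
  exists v, [/\ node (colour_tree s) v, fuel (run s v) = n.+1, A s v & F s v].
Proof.
move=> noB nw l Fw; have [d Ed] : exists d, fuel (run s w) = n.+1 + d.
  by exists (fuel (run s w) - n.+1); rewrite subnKC.
elim: d w nw {l} Ed Fw => [|d IH] w nw Ed Fw.
all: have l : n < fuel (run s w) by lia.
all: have /F_fix[/(noB _ nw l)//|[Aw [c lc Fc]]] := Fw.
  by exists w; rewrite Ed addn0.
apply: (IH (rcons w c)) => //; first exact: node_child.
by rewrite run_rcons /colour_step Ed addnS.
Qed.

(* A node with fuel to spare reaches a copy of [v] by wasting fuel in moves 0
   and then choosing [good]. *)
Lemma fixpoint_imitate s v s' w :
    node (colour_tree s) v -> fuel (run s v) = n.+1 -> A s v -> F s v ->
    node (colour_tree s') w -> n.+1 < fuel (run s' w) ->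
    colour (run s v) = colour (run s' w) ->
  F s' w.
Proof.
move=> nv Ev Av Fv nw l; have [d Ed] : exists d, fuel (run s' w) = n.+2 + d.
  by exists (fuel (run s' w) - n.+2); rewrite subnKC.
elim: d w nw {l} Ed => [|d IH] w nw Ed Ec.
all: have Aw : A s' w by apply: (preserves_high_fuel A_inv nv nw) Av; lia.
all: have aw : colour_arity (run s' w) = 4 by apply: colour_arity_fuel; lia.
all: apply/F_fix; right; split=> //.
  have lg : good (run s v) < 4 by case: good.
  exists (good (run s v) : nat); rewrite /= ?aw //.
  apply: F_run Fv => //; first by apply: node_child; rewrite /= ?aw.
  rewrite /same_run run_rcons /colour_step Ed addn0.
  case: (run s v) Ec Ev => g x e /= -> ->.
  by case: g => /=; rewrite ?orbT addbF.
exists 0; rewrite /= ?aw //.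
apply: IH; rewrite ?run_rcons /colour_step ?Ed ?addnS //= ?addbF //.
by apply: node_child; rewrite /= ?aw.
Qed.

Lemma fixpoint_on_colour s w : node (colour_tree s) w -> n < fuel (run s w) ->
  F s w -> exists x, forall s' w', node (colour_tree s') w' ->
    n.+1 < fuel (run s' w') -> colour (run s' w') = x -> F s' w'.
Proof.
move=> nw l Fw.
have [[v [nv lv Bv]]|noB] :=
    EM (exists v, [/\ node (colour_tree s) v, n < fuel (run s v) & B s v]).
  exists (colour (run s v)) => s' w' nw' l' E; apply/F_fix; left.
  by apply: (preserves_high_fuel B_inv nv nw') Bv; rewrite ?E //; exact: ltnW.
have [v nv lv Bv|v [nv Ev Av Fv]] := fixpoint_descend _ nw l Fw.
  by apply: noB; exists v.
exists (colour (run s v)) => s' w' nw' l' E.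
exact: (fixpoint_imitate nv Ev Av Fv nw' l').
Qed.

Lemma preserves_fixpoint : preserves colour_tree (colour_sim n.+2) F.
Proof.
move=> s w s' w' nw nw' [Ec [[l l']|E]] Fw; last exact: F_run Fw.
have /F_fix[Bw|[Aw _]] := Fw.
  apply/F_fix; left.
  by apply: (preserves_high_fuel B_inv nw nw') Bw => //; lia.
have [|x Fx] := fixpoint_on_colour nw _ Fw; first by lia.
have [Ex|nEx] := boolP (colour (run s' w') == x).
  by apply: (Fx _ _ nw'); [lia | exact/eqP].
have n2 : 2 < arity (colour_tree s') w' by rewrite /= colour_arity_fuel //; lia.
apply/F_fix; right; split.
  by apply: (preserves_high_fuel A_inv nw nw') Aw => //; lia.
exists 2 => //; apply: Fx; first exact: node_child.
all: rewrite run_rcons /colour_step; case: fuel l' => //= d _.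
by rewrite addbT; case: (colour _) x nEx => [] [].
Qed.

End ColourFixpoint.

Lemma preserves_same_run n P :
  preserves colour_tree (colour_sim n) P -> preserves colour_tree same_run P.
Proof.
by move=> pP s w s' w' nw nw' E; apply: pP => //; exact: same_run_colour_sim.
Qed.

Lemma finite_rank_reach_colour :
  finite_rank_closed colour_tree colour_sim (@reach AP).
Proof.
move=> n P Q pP pQ; exists n.+2; apply: (preserves_fixpoint pP pQ).
  exact: (preserves_reach same_run_children (preserves_same_run pP)
                                           (preserves_same_run pQ)).
by move=> s w; exact: reachP.
Qed.

Lemma finite_rank_release_colour :
  finite_rank_closed colour_tree colour_sim (@release AP).
Proof.
move=> n P Q pP pQ; exists n.+2.
apply: (preserves_fixpoint pQ (preserves_and pP pQ)).
  exact: (preserves_release same_run_children (preserves_same_run pP)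
                                           (preserves_same_run pQ)).
by move=> s w; exact: releaseP.
Qed.

Lemma ssat_alternating_sink_good x d :
  ssat (colour_tree (ColourState true x d)) [::] (alternating_sink p).
Proof.
set s := ColourState true x d; apply/ssat_alternating_sink.
have : run s [::] = ColourState true x d by [].
move: (node_root (colour_tree s)) (@ssat_alternating_nil _ p (colour_tree s)).
move: [::] s => w s; elim: d x w => [|d IH] x w nw alt Ew.
  by exists w; split=> //; rewrite /= Ew.
have nw3 : node (colour_tree s) (rcons w 3).
  by apply: node_child; rewrite //= Ew.
have Ew3 : run s (rcons w 3) = ColourState true (~~ x) d.
  by rewrite run_rcons Ew /colour_step /= addbT.
apply: (IH _ _ nw3 _ Ew3); apply/ssat_alternating_rcons => //.
by rewrite !lab_colour_tree Ew3 Ew.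
Qed.

Lemma alternating_stays_bad s w : ~~ good s -> node (colour_tree s) w ->
  ssat (colour_tree s) w (alternating p) -> ~~ good (run s w).
Proof.
move=> bad; elim=> // {}w c nw IH lc /ssat_alternating_rcons[|/IH nE].
  exact: node_child.
rewrite !lab_colour_tree run_rcons /colour_step.
case: fuel => //= d; rewrite (negbTE nE) /= [c < 2]ltnNge.
by case: (1 < c); rewrite ?andbF // addbF; case: colour.
Qed.

Lemma not_ssat_alternating_sink_bad x d :
  ~ ssat (colour_tree (ColourState false x d)) [::] (alternating_sink p).
Proof.
move/ssat_alternating_sink=> [w [nw aw alt]].
have nE := alternating_stays_bad (isT : ~~ good (ColourState false x d)) nw alt.
by move: aw; rewrite /= /colour_arity (negbTE nE); case: fuel.
Qed.

Lemma alternating_sink_not_ctl f :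
  CTL f -> ~ init_equiv f (alternating_sink p).
Proof.
move=> Cf; apply: (@finite_rank_not_equiv _ _ colour_tree colour_sim).
  apply: ctl_finite_rank Cf; first exact: graded_colour_sim.
    exact: finite_rank_reach_colour.
  exact: finite_rank_release_colour.
move=> n; exists (ColourState true true n.+1), (ColourState false true n.+1).
split; [by split=> //; left | exact: ssat_alternating_sink_good |].
exact: not_ssat_alternating_sink_bad.
Qed.

End ColourTrees.

(** * A CTL formula that is not expressible in PastCTL± *)

Section BandTrees.
Variables (AP : finType) (p : AP).
Implicit Types (b : bool) (u v w : seq nat) (x y : nat * bool).

(* The distance to the leftmost branch, or to the root if [b] is false. *)
Definition branch_dist b w : nat :=
  if b then size w - find (predC1 0) w else size w.

Definition band_tree x : tree AP :=
  Tree (fun w => if branch_dist x.2 w < x.1 then [set p] else set0)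
       (fun _ : seq nat => isT : 0 < 2).

Lemma lab_band_tree x w : p \in lab (band_tree x) w <-> branch_dist x.2 w < x.1.
Proof. by rewrite /=; case: ifP; rewrite inE ?eqxx. Qed.

Lemma branch_dist_le_size b w : branch_dist b w <= size w.
Proof. by case: b => //=; exact: leq_subr. Qed.

Lemma branch_dist_rcons b w c :
  branch_dist b (rcons w c) = (branch_dist b w).+1 \/
  branch_dist b (rcons w c) = 0 /\ branch_dist b w = 0.
Proof.
case: b; rewrite /= size_rcons; last by left.
have := find_size (predC1 0) w; rewrite -cats1 find_cat has_find /=.
by case: (c == 0) => /=; case: ltngtP => //=; lia.
Qed.

Lemma branch_dist_rcons1 b w : branch_dist b (rcons w 1) = (branch_dist b w).+1.
Proof.
case: b; rewrite /= size_rcons //.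
have := find_size (predC1 0) w; rewrite -cats1 find_cat has_find /=.
by case: ltngtP => //=; lia.
Qed.

Definition same_depth (n h h' : nat) : Prop := h = h' \/ n < h /\ n < h'.

(* Distances far from the boundary [M] of the band on which [p] holds are told
   apart only by the side on which they lie. *)
Definition same_band (n M d d' : nat) : Prop :=
  d = d' \/ d + n < M /\ d' + n < M \/ M + n < d /\ M + n < d'.

Definition band_sim n x u y v : Prop :=
  (x.1 = y.1 /\ 2 * n + 2 < x.1) /\ same_depth n (size u) (size v) /\
  same_band n x.1 (branch_dist x.2 u) (branch_dist y.2 v).

Lemma band_sim_rcons n x u c y v d :
  band_sim n.+1 x u y v -> band_sim n x (rcons u c) y (rcons v d).
Proof.
rewrite /band_sim /same_depth /same_band !size_rcons.
have := branch_dist_rcons x.2 u c; have := branch_dist_rcons y.2 v d; lia.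
Qed.

Lemma band_sim_belast n x u c y v d :
  band_sim n.+1 x (rcons u c) y (rcons v d) -> band_sim n x u y v.
Proof.
rewrite /band_sim /same_depth /same_band !size_rcons.
have := branch_dist_rcons x.2 u c; have := branch_dist_rcons y.2 v d; lia.
Qed.

Lemma graded_band_sim : graded_simulation band_tree band_sim.
Proof.
split=> [n x u y v|m n x u y v lmn|x u y v|n x u y v c sim lc].
- by rewrite /band_sim /same_depth /same_band; lia.
- by rewrite /band_sim /same_depth /same_band; lia.
- rewrite /band_sim /same_band => -[[E _] [_ Ed]] /=.
  by have -> : (branch_dist x.2 u < x.1) = (branch_dist y.2 v < y.1) by lia.
- by split=> //; exact: band_sim_rcons.
Qed.

Lemma band_sim_last n x u c y v : band_sim n x (rcons u c) y v ->
  exists w d, v = rcons w d.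
Proof.
rewrite /band_sim /same_depth size_rcons => -[_ []].
by case/lastP: v => [/= H _|w d _ _]; [exfalso; lia | exists w, d].
Qed.

Lemma band_sim_parents n : matches_parents (band_sim n.+1) (band_sim n).
Proof.
move=> x u c y v sim; have [w [d Ev]] := band_sim_last sim.
exists w, d; split=> //.
by apply: (@band_sim_belast _ _ _ c _ _ d); rewrite -Ev.
Qed.

Lemma band_sim_parent_stutter n x u c y v d :
  band_sim n x (rcons u c) y (rcons v d) ->
  band_sim n x u y (rcons v d) \/ band_sim n x (rcons u c) y v \/
  band_sim n x u y v.
Proof.
rewrite /band_sim /same_depth /same_band !size_rcons => -[EM [Es Ed]].
have := branch_dist_rcons x.2 u c; have := branch_dist_rcons y.2 v d.
have := branch_dist_le_size x.2 u; have := branch_dist_le_size y.2 v.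
set o := branch_dist x.2 u; set o' := branch_dist y.2 v => lv lu dv du.
have [low_u|[low_v|Es']] : size u <= n < size v \/ size v <= n < size u \/
    same_depth n (size u) (size v) by rewrite /same_depth; lia.
- by right; left; lia.
- by left; lia.
rewrite /same_depth in Es'.
have [out_u|[out_v|Ed']] : o <= x.1 + n < o' \/ o' <= x.1 + n < o \/
    same_band n x.1 o o' by rewrite /same_band; lia.
- by right; left; lia.
- by left; lia.
- by rewrite /same_band in Ed'; right; right; lia.
Qed.

Lemma band_sim_child_stutter n x u c y v : band_sim n x u y v ->
  band_sim n x (rcons u c) y v \/ band_sim n x (rcons u c) y (rcons v 1) \/
  band_sim n x u y (rcons v 1) /\ branch_dist y.2 v < y.1.
Proof.
rewrite /band_sim /same_depth /same_band !size_rcons branch_dist_rcons1.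
move=> [EM [Es Ed]].
have := branch_dist_rcons x.2 u c.
have := branch_dist_le_size x.2 u; have := branch_dist_le_size y.2 v.
set o := branch_dist x.2 u; set o' := branch_dist y.2 v => lv lu du.
have [last_u|[last_v|Edc]] : o' + n + 1 < x.1 <= o + n + 1 \/
    o + n + 1 < x.1 <= o' + n + 1 \/
    (same_band n x.1 o o' /\ same_band n x.1 o.+1 o'.+1)
  by rewrite /same_band; lia.
- by right; right; lia.
- by left; lia.
- by rewrite /same_band in Edc; right; left; lia.
Qed.

(* [S] without [Y] is insensitive to stuttering, so only the sequence of
   distinct classes met on the way to the root matters. *)
Lemma preserves_since_band n P Q :
    preserves band_tree (band_sim n) P -> preserves band_tree (band_sim n) Q ->
  preserves band_tree (band_sim n) (fun x => since (P x) (Q x)).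
Proof.
move=> pP pQ x u y v; have [k] := ubnP (size u + size v).
elim: k u v => // k IH u v lk nu nv sim Su.
case: Su lk nu sim (Su) => [{}u Qu|{}u c Pu Su] lk nu sim Suc.
  by apply: since_here; exact: pQ Qu.
have Pv : P y v by exact: pP Pu.
have [w [d Ev]] := band_sim_last sim; rewrite {v}Ev in lk nv sim Pv *.
have [/node_rcons[nu' _] /node_rcons[nv' _]] := conj nu nv.
rewrite !size_rcons addSn addnS !ltnS in lk.
have [sim'|[sim'|sim']] := band_sim_parent_stutter sim.
- by apply: (IH u) => //; rewrite size_rcons addnS; lia.
- apply: since_child => //; apply: (IH (rcons u c)) => //.
  by rewrite size_rcons addSn; lia.
- by apply: since_child => //; apply: (IH u) => //; lia.
Qed.

(* A step of the path from [u] is imitated from [v] by moving away from the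
   leftmost branch, possibly in several steps or none. *)
Lemma preserves_reach_band n P Q :
    preserves band_tree (band_sim n) P -> preserves band_tree (band_sim n) Q ->
  preserves band_tree (band_sim n) (fun x => reach (band_tree x) (P x) (Q x)).
Proof.
move=> pP pQ x u y v nu nv sim ru.
elim: ru v nu nv sim => {u} [u Qu|u c Pu lc _ IH] v nu nv sim.
  by apply: reach_here; exact: pQ Qu.
have nuc : node (band_tree x) (rcons u c) by exact: node_child.
have [k] := ubnP (y.1 - branch_dist y.2 v).
elim: k v nv sim => // k IHk v nv sim lk.
have Pv : P y v by exact: pP Pu.
have nv1 : node (band_tree y) (rcons v 1) by exact: node_child.
have [sim'|sim'] := band_sim_child_stutter c sim; first exact: IH.
apply: (reach_child (c := 1)) => //; case: sim' => [sim'|[sim' lv]].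
  exact: IH.
by apply: IHk => //; rewrite branch_dist_rcons1; lia.
Qed.

Definition EG_atom : sform AP :=
  SE (PR (PState (SNeg (STrue p))) (PState (SAtom p))).

Lemma ssat_EG_atom_branch M : 0 < M -> ssat (band_tree (M, true)) [::] EG_atom.
Proof.
move=> M0; exists (fun i => nseq i 0); split.
  by split=> // i; exists 0 => //; elim: i => //= i ->.
exists 0; split=> //; left=> i _; apply/(lab_band_tree (M, true)).
by rewrite /= size_nseq find_nseq mul1n subnn.
Qed.

Lemma not_ssat_EG_atom_root M : ~ ssat (band_tree (M, false)) [::] EG_atom.
Proof.
case=> pi [rp [i [_ [|[j _ [nT _ _]]]]]]; last by apply: nT; exact: ssat_True.
move/(_ (maxn i M) (leq_maxl _ _))/(lab_band_tree (M, false)).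
by rewrite /= (root_path_size _ rp) ltnNge leq_maxr.
Qed.

Lemma EG_atom_not_pastctlpm f : PastCTLpm f -> ~ init_equiv f EG_atom.
Proof.
move=> Pf; apply: (@finite_rank_not_equiv _ _ band_tree band_sim).
  apply: pastctlpm_finite_rank Pf; first exact: graded_band_sim.
  - exact: band_sim_parents.
  - by move=> n P Q pP pQ; exists n; exact: preserves_reach_band.
  - by move=> n P Q pP pQ; exists n; exact: preserves_since_band.
move=> n; exists (2 * n + 3, true), (2 * n + 3, false); split.
- by rewrite /band_sim /same_depth /same_band /=; lia.
- by apply: ssat_EG_atom_branch; rewrite addn3.
- exact: not_ssat_EG_atom_root.
Qed.

End BandTrees.

Lemma strictly_less_sub (AP : finType) (L1 L2 : sform AP -> bool) g :
    (forall f, L1 f -> L2 f) -> L2 g -> (forall f, L1 f -> ~ init_equiv f g) ->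
  strictly_less L1 L2.
Proof.
move=> sub12 L2g L1g; split; last by exists g.
by exists id => f /sub12.
Qed.

Theorem theorem3p2 (AP : finType) (p0 : AP) :
  (forall f : sform AP, CTLpm f -> PastCTLpm f) /\
  (forall f : sform AP, PastCTLpm f -> PastCTL f) /\
  strictly_less (@CTLpm AP) (@PastCTLpm AP) /\
  incomparable (@PastCTLpm AP) (@CTL AP) /\
  strictly_less (@PastCTLpm AP) (@PastCTL AP).
Proof.
split; first exact: is_ctlpm_past.
split; first exact: is_ctlpm_pctl.
split; last split.
- apply: (@strictly_less_sub _ _ _ (alternating_sink p0)) => // f.
    exact: is_ctlpm_past.
  by move/is_ctlpm_pctl; exact: alternating_sink_not_ctl.
- split.
    exists (alternating_sink p0); split=> // f Cf /init_equiv_sym.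
    exact: alternating_sink_not_ctl.
  exists (EG_atom p0); split=> // f Pf /init_equiv_sym.
  exact: EG_atom_not_pastctlpm.
apply: (@strictly_less_sub _ _ _ (EG_atom p0)) => // f.
  exact: is_ctlpm_pctl.
exact: EG_atom_not_pastctlpm.
Qed.
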